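(* Let $K$ be a henselian valued field with valuation ring $\mathcal{O}$ and residue field $F$. Suppose that $F$ is finite or pseudo-algebraically closed, and that the algebraic part $F_{\rm alg}$ of $F$ is not algebraically closed. Then there exists an $\exists$-$\emptyset$-definition of $\mathcal{O}$ in $K$.
   Context: $\mathcal{L}=\{+,-,\cdot,0,1\}$ is the language of rings. An $\exists$-$\emptyset$-formula is an existential $\mathcal{L}$-formula without parameters. For a formula $\varphi(x)$ in one free variable, $\varphi(K)$ denotes the subset of $K$ that it defines. An $\exists$-$\emptyset$-definition of $\mathcal{O}$ in $K$ is an $\exists$-$\emptyset$-formula $\varphi(x)$ with $\varphi(K)=\mathcal{O}$. A field $F$ is pseudo-algebraically closed (PAC) if every (non-empty) absolutely irreducible variety defined over $F$ has an $F$-rational point. The algebraic part $F_{\rm alg}$ of $F$ is the (relative) algebraic closure in $F$ of the prime field of $F$. *)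

(* Defs.v *)
From HB Require Import structures.
From mathcomp Require Import all_boot all_order all_algebra.
From mathcomp Require Import mpoly.

Set Implicit Arguments.
Unset Strict Implicit.
Unset Printing Implicit Defensive.

Import GRing.Theory.
Local Open Scope ring_scope.

(* A valued field is given by its valuation ring, which determines the        *)
(* valuation up to equivalence; the trivial valuation ring O = K is allowed.  *)
HB.mixin Record isValuationRing (K : fieldType) (O : K -> bool) := {
  valuation_ring_total :
    forall x : K, (x \in (O : {pred K})) || (x^-1 \in (O : {pred K}))
}.

#[short(type="valuationRing")]
HB.structure Definition ValuationRing (K : fieldType) :=
  {O of GRing.SubringClosed K O & isValuationRing K O}.

Section ResidueField.

Variables (K : fieldType) (O : valuationRing K).

Record valring : predArgType :=
  ValRing { valring_val :> K; _ : valring_val \in O }.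

HB.instance Definition _ := [isSub for valring_val].
HB.instance Definition _ := [Choice of valring by <:].
HB.instance Definition _ := [SubChoice_isSubComNzRing of valring by <:].

(* The zero test is needed because 0^-1 = 0 lies in O.                        *)
Definition maxideal : pred valring :=
  fun a => (val a == 0) || ((val a)^-1 \notin O).

Lemma maxideal_closed : idealr_closed maxideal.
Proof.
have memV (x : K) : x \notin O -> x^-1 \in O.
  by move=> nOx; have := @valuation_ring_total K O x; rewrite (negPf nOx).
have inE' a : (a \in maxideal) = (val a == 0) || ((val a)^-1 \notin O) by [].
have memM a u : u \in maxideal -> a * u \in maxideal.
  rewrite !inE' rmorphM /=; have [->|a0] := eqVneq (val a) 0.
    by rewrite mul0r eqxx.
  have [->|u0] := eqVneq (val u) 0; first by rewrite mulr0 eqxx.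
  rewrite (negPf (mulf_neq0 a0 u0)) /=; apply: contraNN => Oau.
  have -> : (val u)^-1 = val a * (val a * val u)^-1.
    by rewrite invfM mulrA mulfV // mul1r.
  exact: rpredM (valP a) Oau.
split; first by rewrite inE' raddf0 eqxx.
  by rewrite inE' rmorph1 oner_eq0 invr1 rpred1.
suff memD u v : val v != 0 -> val u / val v \in O -> v \in maxideal ->
    u + v \in maxideal.
  move=> a u v /(memM a); move: (a * u) => {a} {}u mu mv.
  have [v0|v0] := eqVneq (val v) 0.
    by have -> : v = 0 by [apply: val_inj; rewrite v0 raddf0]; rewrite addr0.
  have [u0|u0] := eqVneq (val u) 0.
    by have -> : u = 0 by [apply: val_inj; rewrite u0 raddf0]; rewrite add0r.
  have [Ouv|/memV] := boolP (val u / val v \in O); first exact: memD.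
  by rewrite invf_div => Ovu; rewrite addrC; apply: memD.
move=> v0 Ouv; rewrite inE' (negPf v0) /= => nOv.
have uvE : val (u + v) = val u + val v by [].
rewrite inE' uvE.
have [//|uv0] := eqVneq (val u + val v) 0; apply: contraNN nOv => Ouv'.
have -> : (val v)^-1 = (val u / val v + 1) * (val u + val v)^-1.
  by rewrite -(divff v0) -mulrDl mulrAC mulfV // mul1r.
by rewrite rpredM // rpredD // rpred1.
Qed.

HB.instance Definition _ := isIdealr.Build valring maxideal maxideal_closed.

Definition residue_field : Type := {ideal_quot (maxideal : idealr valring)}.

HB.instance Definition _ := GRing.ComNzRing.on residue_field.

Definition residue (a : valring) : residue_field :=
  (\pi_{ideal_quot (maxideal : idealr valring)} a)%qT.

Lemma residue_eq0 a : (residue a == 0) = (a \in maxideal).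
Proof.
by rewrite /residue -(rmorph0 (\pi_{ideal_quot (maxideal : idealr valring)}%qT))
  -Quotient.idealrBE subr0.
Qed.

Lemma residue_zmod_morphism : zmod_morphism residue.
Proof. by move=> a b; rewrite /residue raddfB. Qed.

Lemma residue_monoid_morphism : monoid_morphism residue.
Proof. by split=> [|a b]; rewrite /residue ?rmorph1 ?rmorphM. Qed.

HB.instance Definition _ :=
  GRing.isZmodMorphism.Build valring residue_field residue residue_zmod_morphism.
HB.instance Definition _ :=
  GRing.isMonoidMorphism.Build valring residue_field residue
    residue_monoid_morphism.

Lemma valring_unitP a : a \notin maxideal -> (val a)^-1 \in O.
Proof. by rewrite negb_or negbK => /andP[]. Qed.

Definition residue_inv (x : residue_field) : residue_field :=
  let a := repr (x : {ideal_quot (maxideal : idealr valring)}) in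
  oapp residue 0 (insub (val a)^-1).

Lemma residue_mulVf x : x != 0 -> residue_inv x * x = 1.
Proof.
have {1 3}<- : residue (repr x) = x by apply: reprK.
rewrite residue_eq0 /residue_inv => mx; have Oa := valring_unitP mx.
rewrite (insubT (fun y : K => y \in O) Oa) /= -rmorphM -(rmorph1 residue).
congr residue; apply: val_inj; rewrite rmorphM rmorph1 /=.
by rewrite mulVf //; move: mx; rewrite negb_or => /andP[].
Qed.

Lemma residue_invr0 : residue_inv 0 = 0.
Proof.
rewrite /residue_inv; set a := repr _.
have: a \in maxideal by rewrite -residue_eq0; apply/eqP/reprK.
case: insubP => //= b Ob bE /orP[/eqP a0|]; last by rewrite Ob.
apply/eqP; rewrite residue_eq0; apply/orP; left.
by apply/eqP; apply: (etrans bE); rewrite a0 invr0.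
Qed.

HB.instance Definition _ :=
  GRing.ComNzRing_isField.Build residue_field residue_mulVf residue_invr0.

End ResidueField.

(* Simple zeros of the reduction of f lift to zeros of f.                     *)
Definition henselian (K : fieldType) (O : valuationRing K) : Prop :=
  forall (f : {poly valring O}) (alpha : residue_field O),
    root (map_poly (@residue K O) f) alpha ->
    ~~ root (map_poly (@residue K O) f)^`() alpha ->
    exists2 a : valring O, root f a & residue a = alpha.

Definition finite_field (F : fieldType) : Prop :=
  exists s : seq F, forall x : F, x \in s.

Definition generated_ideal (R : comNzRingType) (m : nat) (g : 'I_m -> R) (p : R)
    : Prop :=
  exists h : 'I_m -> R, p = \sum_i h i * g i.

Definition generates_prime_ideal (R : comNzRingType) (m : nat) (g : 'I_m -> R)
    : Prop :=
  ~ generated_ideal g 1 /\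
  forall p q : R, generated_ideal g (p * q) ->
    generated_ideal g p \/ generated_ideal g q.

Definition is_algebraic_closure (F : fieldType) (L : closedFieldType)
    (iota : {rmorphism F -> L}) : Prop :=
  forall z : L, algebraicOver iota z.

(* An affine variety in A^n over F is presented by equations f over F. It is  *)
(* nonempty, absolutely irreducible and defined over F when f generates a     *)
(* prime ideal over the algebraic closure L of F: irreducibility of the zero  *)
(* set in L^n alone would not suffice, as over an imperfect F of              *)
(* characteristic p the equation X^p = t would then have to be solvable.      *)
(* Quantifying over all L is harmless: L is unique up to isomorphism over F.  *)
Definition absolutely_irreducible (F : fieldType) (n m : nat)
    (f : 'I_m -> {mpoly F[n]}) : Prop :=
  forall (L : closedFieldType) (iota : {rmorphism F -> L}),
    is_algebraic_closure iota ->
    generates_prime_ideal (fun i : 'I_m => map_mpoly iota (f i)).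

(* Affine varieties suffice, as a nonempty variety has a nonempty affine open *)
(* subvariety.                                                                *)
Definition pseudo_algebraically_closed (F : fieldType) : Prop :=
  forall (n m : nat) (f : 'I_m -> {mpoly F[n]}),
    absolutely_irreducible f ->
    exists x : 'I_n -> F, forall i : 'I_m, (f i).@[x] = 0.

Definition prime_field (F : fieldType) (x : F) : Prop :=
  forall S : {pred F}, divring_closed S -> x \in S.

Definition algebraic_part (F : fieldType) (x : F) : Prop :=
  exists p : {poly F},
    [/\ p != 0, forall i : nat, prime_field p`_i & root p x].

Arguments algebraic_part F x : clear implicits.

Definition algebraically_closed_subfield (F : fieldType) (A : F -> Prop)
    : Prop :=
  forall p : {poly F}, (1 < size p)%N -> (forall i : nat, A p`_i) ->
    exists2 x : F, A x & root p x.

(* The type of formulas allows parameters from R (Const) and symbols outside  *)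
(* the language {+,-,.,0,1}; these are excluded, including the abbreviations  *)
(* NatMul, Exp and numerals other than 0 and 1. The sequence vs lists the     *)
(* variables that may occur free.                                             *)
Fixpoint ring_term (R : Type) (vs : seq nat) (t : GRing.term R) : bool :=
  match t with
  | GRing.Var i => i \in vs
  | GRing.NatConst k => (k <= 1)%N
  | GRing.Add t1 t2 | GRing.Mul t1 t2 => ring_term vs t1 && ring_term vs t2
  | GRing.Opp t1 => ring_term vs t1
  | GRing.Const _ | GRing.NatMul _ _ | GRing.Inv _ | GRing.Exp _ _ => false
  end.

Fixpoint ring_qf_formula (R : Type) (vs : seq nat) (f : GRing.formula R)
    : bool :=
  match f with
  | GRing.Bool _ => true
  | GRing.Equal t1 t2 => ring_term vs t1 && ring_term vs t2
  | GRing.And f1 f2 | GRing.Or f1 f2 | GRing.Implies f1 f2 =>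
      ring_qf_formula vs f1 && ring_qf_formula vs f2
  | GRing.Not f1 => ring_qf_formula vs f1
  | GRing.Unit _ | GRing.Exists _ _ | GRing.Forall _ _ => false
  end.

Fixpoint existential_formula (R : Type) (vs : seq nat) (f : GRing.formula R)
    : bool :=
  match f with
  | GRing.Exists i f1 => existential_formula (i :: vs) f1
  | _ => ring_qf_formula vs f
  end.

(* The free variable is 'X_0.                                                 *)
Definition existential_definition (K : fieldType) (A : {pred K})
    (phi : GRing.formula K) : Prop :=
  existential_formula [:: 0%N] phi /\
  forall x : K, GRing.holds [:: x] phi <-> x \in A.

(* Main.v *)
(* Let F be the residue field and m the maximal ideal of O. If f in Z[X] has   *)
(* a leading coefficient that is nonzero in F and no zero in F, then 1/f(x)    *)
(* lies in O for every x in K; if moreover f' does not vanish identically on   *)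
(* F, then by Hensel's lemma the set U of all 1/f(z) - 1/f(w) contains m, so   *)
(* U is an existentially definable set between m and O.                        *)
(* If F is finite, with x^n = x on F, take f = X^n - X + 1: as f = 1 on F,     *)
(* x lies in O iff f(x) f(y) = 1 has a solution y.                             *)
(* If F is infinite and PAC, take for f a separable polynomial over Z without  *)
(* zeros in F. The curve f(X) f(Y) = c with c != 0 is absolutely irreducible,  *)
(* so O is the union of U and of the sets 1/(f(x) f(y)) + U.                   *)
(* Such an f exists: if every separable polynomial over the prime field had a  *)
(* zero in F, then so would the minimal polynomial of a primitive element of   *)
(* any normal extension of the prime field (in characteristic p, a cyclotomic  *)
(* polynomial). So every polynomial over the prime field would split in F, and *)
(* F would contain all zeros of polynomials over its algebraic part.           *)
From HB Require Import structures.
Require Import Defs.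
From Stdlib Require Import Classical ClassicalEpsilon.
From mathcomp Require Import all_boot all_order all_algebra.
From mathcomp Require Import all_field.
From mathcomp Require Import mpoly.

Set Implicit Arguments.
Unset Strict Implicit.
Unset Printing Implicit Defensive.

Import GRing.Theory Num.Theory.
Local Open Scope ring_scope.

(** If an integer polynomial f keeps its degree over F and has no zero there, every value 1/f(x)
    lies in O: on O because f has no zero modulo m, off O because its leading term dominates
    ([intpoly_inv_valring]). Sums, differences and products of such values stay in O, so it remains
    to see that suitable ones exhaust O. Hensel's lemma yields m as differences of two values
    ([maxideal_difference]), and residues are reached by solving f(X) f(Y) = c over F. For PAC F
    this is [pac_product_solution], which rests on [product_curve_irreducible]: a simple zero a of f
    makes an Eisenstein argument at X - a possible. For finite F, an f equal to 1 on F makes the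
    single equation f(x) f(y) = 1 define O. The arithmetic input is [exists_int_poly_without_root]:
    if there were no such separable f, then roots of unity (characteristic p) or primitive elements
    (characteristic 0) would bring every element algebraic over the prime field into F. *)

Local Notation intpoly R f := (map_poly intr f : {poly R}).

(** * Absolute irreducibility of f(X) f(Y) = c *)

Section ProductCurve.

Import Pdiv.WeakIdomain Pdiv.CommonIdomain.

Variables (L : fieldType) (f : {poly L}) (a c : L).

Definition product_curve : {poly {poly L}} := f *: f^:P - c%:P%:P.

Hypotheses (fa0 : root f a) (f'a : f^`().[a] != 0) (c0 : c != 0).

Lemma simple_root_size_gt1 : (1 < size f)%N.
Proof.
apply: contraNT f'a; rewrite -leqNgt => /size1_polyC ->.
by rewrite derivC horner0.
Qed.

Lemma simple_root_neq0 : f != 0.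
Proof. by rewrite -size_poly_gt0 (ltn_trans _ simple_root_size_gt1). Qed.

Let curve_size_aux : (size (- c%:P%:P : {poly {poly L}}) < size (f *: f^:P))%N.
Proof.
rewrite size_scale ?simple_root_neq0 // size_map_polyC size_polyN.
by rewrite (leq_ltn_trans (size_polyC_leq1 _)) ?simple_root_size_gt1.
Qed.

Lemma size_product_curve : size product_curve = size f.
Proof.
by rewrite size_polyDl // size_scale ?simple_root_neq0 // size_map_polyC.
Qed.

Lemma lead_coef_product_curve : lead_coef product_curve = lead_coef f *: f.
Proof.
rewrite lead_coefDl // lead_coefZ lead_coef_map_inj ?rmorph0 //;
  last exact: polyC_inj.
by rewrite mulrC mul_polyC.
Qed.

Lemma map_horner_eval0_scale (q : {poly {poly L}}) :
  map_poly (horner_eval a) q = 0 -> exists q1, q = ('X - a%:P) *: q1.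
Proof.
move=> q0; exists (map_poly (fun u : {poly L} => (u %/ ('X - a%:P))%R) q).
apply/polyP => i; rewrite coefZ coef_map_id0 ?div0p //.
rewrite mulrC; apply/eqP; rewrite -Pdiv.Field.dvdp_eq dvdp_XsubCl.
by have /polyP/(_ i) := q0; rewrite coef_map coef0 /= => /eqP.
Qed.

(* Eisenstein's argument for the prime X - a: it divides the leading           *)
(* coefficient f(X) exactly once and all other coefficients but the constant. *)
Lemma product_curve_no_factor (d : {poly L}) (q r : {poly {poly L}}) :
  d != 0 -> d *: product_curve = q * r -> (1 < size q)%N -> (1 < size r)%N ->
  False.
Proof.
have Xa0 : 'X - a%:P != 0 :> {poly L} by rewrite polyXsubC_eq0.
have XaI : injective (GRing.scale ('X - a%:P) : {poly {poly L}} -> _).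
  by move=> u v; rewrite -!mul_polyC => /mulfI; apply; rewrite polyC_eq0.
(* The factor d is a cleared denominator of a factorization over L(X); the induction is on its
   size. *)
move: {2}(size d).+1 (ltnSn (size d)) => n; elim: n d q r => // n IHn d q r.
rewrite ltnS => dn d0 E q1 r1.
have: map_poly (horner_eval a) (d *: product_curve)
    = map_poly (horner_eval a) q * map_poly (horner_eval a) r.
  by rewrite E rmorphM.
have -> : map_poly (horner_eval a) (d *: product_curve) = (- (d.[a] * c))%:P.
  rewrite -mul_polyC rmorphM /= map_polyC /= /product_curve rmorphB /=.
  rewrite -mul_polyC rmorphM /= !map_polyC /= /horner_eval (rootP fa0) mul0r
    sub0r.
  by rewrite hornerC mulrN -rmorphM rmorphN.
(* If X - a divides d, it divides q or r, and it is cancelled from both sides. *)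
case: (eqVneq d.[a] 0) => da.
  rewrite da mul0r oppr0 => /esym/eqP; rewrite mulf_eq0.
  have [d1 dE] : exists d1, d = d1 * ('X - a%:P).
    by apply/Pdiv.Field.dvdpP; rewrite dvdp_XsubCl; apply/eqP.
  have d10 : d1 != 0 by apply: contraNneq d0 => d10; rewrite dE d10 mul0r.
  have dn1 : (size d1 < n)%N.
    by move: dn; rewrite dE size_mul // size_XsubC addn2.
  case/orP => /eqP/map_horner_eval0_scale[u uE].
    apply: (IHn d1 u r) => //; last first.
      by move: q1; rewrite uE size_scale.
    apply: XaI; rewrite scalerA mulrC -dE E uE.
    by rewrite scalerAl.
  apply: (IHn d1 q u) => //; last first.
    by move: r1; rewrite uE size_scale.
  apply: XaI; rewrite scalerA mulrC -dE E uE.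
  by rewrite scalerAr.
move=> Eev.
have ev0 : (- (d.[a] * c))%:P != 0 :> {poly L}.
  by rewrite polyC_eq0 oppr_eq0 mulf_neq0.
have evq : map_poly (horner_eval a) q != 0.
  by apply: contraNneq ev0; rewrite Eev => ->; rewrite mul0r.
have evr : map_poly (horner_eval a) r != 0.
  by apply: contraNneq ev0; rewrite Eev => ->; rewrite mulr0.
have sizes : size (map_poly (horner_eval a) q) = 1%N
          /\ size (map_poly (horner_eval a) r) = 1%N.
  have /(congr1 (fun p : {poly L} => size p)) := Eev.
  rewrite size_polyC oppr_eq0 mulf_neq0 //= size_mul //.
  move: evq evr; rewrite -!size_poly_gt0.
  by case: (size _) => [//|[|m]]; case: (size _) => [//|[|k]] //=;
    rewrite ?addnS.
(* Now q and r are nonzero constants modulo X - a, so both leading coefficients vanish at a. Their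
   product has a double zero there, while f has a simple one and d none. *)
have lead0 (u : {poly {poly L}}) : (1 < size u)%N ->
    size (map_poly (horner_eval a) u) = 1%N -> (lead_coef u).[a] = 0.
  move=> u1 us; have : (map_poly (horner_eval a) u)`_(size u).-1 = 0.
    by rewrite nth_default // us; case: (size u) u1 => [|[]].
  by rewrite coef_map.
have /(congr1 lead_coef) := E; rewrite lead_coefZ lead_coefM.
rewrite lead_coef_product_curve => /(congr1 (fun p => p^`().[a])).
rewrite !derivM !hornerD !hornerM (lead0 q q1 sizes.1) (lead0 r r1 sizes.2).
rewrite derivZ !hornerZ (rootP fa0) !mulr0 mul0r addr0 add0r => /eqP.
by rewrite !mulf_eq0 (negPf da) (negPf f'a) lead_coef_eq0 (negPf
  simple_root_neq0).
Qed.

(** Over the domain L[X], [%|] is pseudo-divisibility, which allows denominators; this is thus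
    irreducibility in Y over L(X). *)
Lemma product_curve_irreducible : irreducible_poly product_curve.
Proof.
have h0 : product_curve != 0.
  by rewrite -size_poly_gt0 size_product_curve (ltn_trans _
    simple_root_size_gt1).
split; first by rewrite size_product_curve simple_root_size_gt1.
move=> q q1 qh; have /dvdpP[[d r] /= d0 E] := qh.
have rq0 : r * q != 0 by rewrite -E -mul_polyC mulf_neq0 ?polyC_eq0.
move: rq0; rewrite mulf_eq0 negb_or => /andP[r0 q0].
have q_gt1 : (1 < size q)%N.
  by move: q1 q0; rewrite -size_poly_eq0; case: (size q) => [|[]].
rewrite -(dvdp_size_eqp qh).
have [r_gt1|] := ltnP 1 (size r).
  by case: (product_curve_no_factor d0 E).
move=> r_le1; have r1 : size r = 1%N.
  by apply/eqP; rewrite eqn_leq r_le1 size_poly_gt0.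
have /(congr1 (fun p : {poly {poly L}} => size p)) := E.
by rewrite size_scale // size_mul // r1 add1n /= => ->.
Qed.

(* On the curve, f(X) is a unit with inverse f(Y)/c; this replaces Gauss's     *)
(* lemma in passing from divisibility over L(X) to divisibility over L[X].     *)
Lemma product_curve_dvdP (q : {poly {poly L}}) :
  product_curve %| q -> exists g, q = g * product_curve.
Proof.
rewrite dvdp_eq lead_coef_product_curve.
set k := scalp _ _; set u := (q %/ _)%R => /eqP E.
have lc0 : lead_coef f ^+ k * c ^+ k != 0.
  by rewrite mulf_neq0 // expf_neq0 // lead_coef_eq0 simple_root_neq0.
(* Modulo the curve, (f(X) f(Y))^k is c^k. Multiplying [E] by f(Y)^k therefore turns the factor
   f(X)^k left by pseudo-division into a nonzero constant. *)
have [v vE] : exists v, (f *: f^:P) ^+ k = c%:P%:P ^+ k + v * product_curve.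
  exists (\sum_(i < k) (f *: f^:P) ^+ (k.-1 - i) * c%:P%:P ^+ i).
  apply/eqP; rewrite addrC -subr_eq; apply/eqP.
  by rewrite subrXX mulrC.
have E2 : (lead_coef f ^+ k)%:P%:P * ((f *: f^:P) ^+ k * q)
        = f^:P ^+ k * u * product_curve.
  rewrite -mulrA -E !exprZn -!mul_polyC !polyCM.
  by rewrite -!mulrA [RHS]mulrCA; congr (_ * _); rewrite mulrCA.
exists (((lead_coef f ^+ k * c ^+ k)^-1)%:P%:P *
   (f^:P ^+ k * u - (lead_coef f ^+ k)%:P%:P * v * q)).
have e : ((lead_coef f ^+ k * c ^+ k)^-1)%:P%:P *
    ((lead_coef f ^+ k)%:P%:P * c%:P%:P ^+ k)
    = 1 :> {poly {poly L}}.
  by rewrite -!rmorphXn -!rmorphM /= mulVf.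
rewrite -[RHS]mulrA [X in _ = _ * X]mulrBl -E2 vE. rewrite -[LHS]mul1r -e.
rewrite -!mulrA; congr (_ * _); rewrite mulrDl mulrDr.
by rewrite [q * _]mulrC [v * (_ * q)]mulrA addrK.
Qed.

Lemma product_curve_prime (q r : {poly {poly L}}) :
  (exists g, q * r = g * product_curve) ->
  (exists g, q = g * product_curve) \/ (exists g, r = g * product_curve).
Proof.
case=> g E; have hqr : product_curve %| q * r.
  by apply/dvdpP; exists (1, g) => /=; rewrite ?oner_eq0 ?scale1r.
have [hq|hNq] := boolP (product_curve %| q); first by left;
  apply: product_curve_dvdP.
right; apply: product_curve_dvdP; rewrite -(@Gauss_dvdpr _ r q) //.
rewrite /coprimep; apply: contraNT hNq => gcd1.
have /(_ (gcdp product_curve q)) := apply_irredp product_curve_irreducible.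
move=> /(_ gcd1 (dvdp_gcdl _ _))/eqp_dvdl <-; exact: dvdp_gcdr.
Qed.

Lemma product_curve_proper (g : {poly {poly L}}) : 1 <> g * product_curve.
Proof.
move=> /esym E; have : product_curve %| 1.
  by apply/dvdpP; exists (1, g) => /=; rewrite ?oner_eq0 ?scale1r.
rewrite dvdp1 size_product_curve => /eqP s1.
by have := simple_root_size_gt1; rewrite s1.
Qed.

End ProductCurve.

(** * The curve in two variables and the PAC property *)

Section Bivariate.

Variable L : fieldType.

Definition poly_of_mpoly2 : {mpoly L[2]} -> {poly {poly L}} :=
  mmap (polyC \o polyC) (fun i => if i == ord0 then 'X%:P else 'X).

HB.instance Definition _ := GRing.RMorphism.on poly_of_mpoly2.

Definition mpoly2_of_poly : {poly {poly L}} -> {mpoly L[2]} :=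
  horner_eval 'X_ord_max \o
    map_poly (horner_eval 'X_ord0 \o map_poly (@mpolyC 2 L)).

HB.instance Definition _ := GRing.RMorphism.on mpoly2_of_poly.

Lemma poly_of_mpoly2K : cancel poly_of_mpoly2 mpoly2_of_poly.
Proof.
move=> p; rewrite [RHS]mpolyE /poly_of_mpoly2 /mmap rmorph_sum /=.
apply: eq_bigr => m _; rewrite rmorphM rmorph_prod /= -mul_mpolyC;
  congr (_ * _).
  by rewrite /mpoly2_of_poly /= map_polyC /= /horner_eval hornerC map_polyC /=
    hornerC.
rewrite mpolyXE_id; apply: eq_bigr => i _; rewrite rmorphXn /=; congr (_ ^+ _).
rewrite /mpoly2_of_poly /=; case: eqP => [->|i0].
  by rewrite map_polyC /= /horner_eval hornerC map_polyX hornerX.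
rewrite map_polyX /horner_eval hornerX; have -> // : i = ord_max.
by apply/val_inj; case: i i0 => [[|[|]]] //= ? []; apply/val_inj.
Qed.

End Bivariate.

Arguments poly_of_mpoly2 {L}.
Arguments mpoly2_of_poly {L}.

Definition mpoly_at (F : fieldType) n (f : {poly F}) (i : 'I_n) :
  {mpoly F[n]} :=
  (map_poly (@mpolyC n F) f).['X_i].

Definition mproduct_curve (F : fieldType) (f : {poly F}) (c : F) :
  {mpoly F[2]} :=
  mpoly_at f ord0 * mpoly_at f ord_max - c%:MP.

Lemma poly_of_mpoly_at (L : fieldType) (f : {poly L}) i :
  poly_of_mpoly2 (mpoly_at f i) = if i == ord0 then f%:P else f^:P.
Proof.
rewrite /mpoly_at -horner_map -map_poly_comp /=.
have eC : poly_of_mpoly2 \o @mpolyC 2 L =1 polyC \o polyC.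
  by move=> x; rewrite /= /poly_of_mpoly2 mmapC.
rewrite (eq_map_poly eC) {eC} [poly_of_mpoly2 _]mmapX mmap1U map_poly_comp.
case: ifP => _; last by rewrite -/(comp_poly _ _) comp_polyXr.
by rewrite horner_map -/(comp_poly _ _) comp_polyXr.
Qed.

Lemma poly_of_mproduct_curve (L : fieldType) (f : {poly L}) c :
  poly_of_mpoly2 (mproduct_curve f c) = product_curve f c.
Proof.
rewrite /mproduct_curve rmorphD rmorphN rmorphM /= !poly_of_mpoly_at /=.
by rewrite mul_polyC [poly_of_mpoly2 _]mmapC.
Qed.

Lemma map_mproduct_curve (F L : fieldType) (iota : {rmorphism F -> L}) f c :
  map_mpoly iota (mproduct_curve f c) =
  mproduct_curve (map_poly iota f) (iota c).
Proof.
rewrite /mproduct_curve rmorphB rmorphM /= /mpoly_at -!horner_map /=.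
rewrite -!map_poly_comp map_mpolyC !map_mpolyX.
have eC : map_mpoly iota \o @mpolyC 2 F =1 @mpolyC 2 L \o iota.
  by move=> x; rewrite /= map_mpolyC.
by rewrite !(eq_map_poly eC).
Qed.

Lemma meval_mproduct_curve (F : fieldType) (f : {poly F}) c (x : 'I_2 -> F) :
  (mproduct_curve f c).@[x] = f.[x ord0] * f.[x ord_max] - c.
Proof.
rewrite /mproduct_curve rmorphB rmorphM /= /mpoly_at -!horner_map /= mevalC.
rewrite -!map_poly_comp !mevalXU.
have eC : meval x \o @mpolyC 2 F =1 id by move=> y; rewrite /= mevalC.
by rewrite !(eq_map_poly eC) !map_poly_id.
Qed.

(** A separable f has a simple zero over the closed field L, as the Eisenstein argument requires.
    The ring maps between the two models of L[X,Y] transport membership in the principal ideal. *)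
Lemma mproduct_curve_absolutely_irreducible (F : fieldType) (f : {poly F}) c :
  (1 < size f)%N -> separable_poly f -> c != 0 ->
  absolutely_irreducible (fun _ : 'I_1 => mproduct_curve f c).
Proof.
move=> f1 sepf c0 L iota _.
have /closed_rootP[a fa] : size (map_poly iota f) != 1%N.
  by rewrite size_map_poly; case: (size f) f1 => [|[]].
have f'a : (map_poly iota f)^`().[a] != 0.
  apply: Pdiv.CommonIdomain.coprimep_root fa.
  by have := sepf; rewrite -(separable_map iota) unlock.
have ic0 : iota c != 0 by rewrite fmorph_eq0.
set g := fun _ => _.
have idealP p : generated_ideal g p -> exists u,
    poly_of_mpoly2 p = u * product_curve (map_poly iota f) (iota c).
  case=> h ->; exists (poly_of_mpoly2 (h ord0)).
  by rewrite big_ord1 /g map_mproduct_curve rmorphM /= poly_of_mproduct_curve.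
have idealV p u :
    poly_of_mpoly2 p = u * product_curve (map_poly iota f) (iota c) ->
    generated_ideal g p.
  move=> pE; exists (fun=> mpoly2_of_poly u);
    rewrite big_ord1 /g map_mproduct_curve.
  rewrite -[LHS]poly_of_mpoly2K pE rmorphM /=; congr (_ * _).
  by rewrite -poly_of_mproduct_curve poly_of_mpoly2K.
split=> [/idealP[u]|p q /idealP[u]].
  by rewrite rmorph1 => /(product_curve_proper f'a).
rewrite rmorphM => pqE.
have [|[v vE]|[v vE]] := product_curve_prime fa f'a ic0 (q := poly_of_mpoly2 p)
  (r := poly_of_mpoly2 q); first by exists u.
- by left; apply: idealV vE.
- by right; apply: idealV vE.
Qed.

Lemma pac_product_solution (F : fieldType) (f : {poly F}) c :
  pseudo_algebraically_closed F ->
  (1 < size f)%N -> separable_poly f -> c != 0 -> exists x y, f.[x] * f.[y] = c.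
Proof.
move=> pacF f1 sepf c0.
have [x /(_ ord0)] := 
  pacF _ _ _ (mproduct_curve_absolutely_irreducible f1 sepf c0).
by rewrite meval_mproduct_curve => /eqP; rewrite subr_eq0 => /eqP;
  exists (x ord0), (x ord_max).
Qed.

(** * The algebraic part of a field *)

(** [prime_field] quantifies over boolean predicates; informative excluded middle makes P one of
    them. *)
Lemma prime_field_ind (F : fieldType) (P : F -> Prop) :
  P 1 -> (forall x y, P x -> P y -> P (x - y)) ->
  (forall x y, P x -> P y -> P (x / y)) ->
  forall x, prime_field x -> P x.
Proof.
move=> P1 PB PV x /(_ (fun y => excluded_middle_informative (P y))).
have E y : reflect (P y)
    (y \in (fun y => excluded_middle_informative (P y) : bool)).
  by rewrite unfold_in /=; case: excluded_middle_informative => Py; constructor.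
move=> H; apply/E; apply: H.
by split=> [|u v /E Pu /E Pv|u v /E Pu /E Pv]; apply/E; auto.
Qed.

Lemma prime_field_div (F : fieldType) (x y : F) :
  prime_field x -> prime_field y -> prime_field (x / y).
Proof.
by move=> Px Py S Scl; case: (Scl) => _ _; apply; [apply: Px | apply: Py].
Qed.

Lemma prime_field_fmorph (F0 F : fieldType) (phi : {rmorphism F0 -> F})
    (x : F) :
  prime_field x -> exists r, x = phi r.
Proof.
move: x; apply: prime_field_ind => [|_ _ [u ->] [v ->]|_ _ [u ->] [v ->]].
- by exists 1; rewrite rmorph1.
- by exists (u - v); rewrite rmorphB.
- by exists (u / v); rewrite fmorph_div.
Qed.

Lemma prime_field_int (F : fieldType) (k : int) : prime_field (k%:~R : F).
Proof.
move=> S [S1 SB SV].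
have S0 : 0 \in S by rewrite -(subrr 1) SB.
have SN x : x \in S -> - x \in S by rewrite -[- x]sub0r; apply: SB.
have Sn (n : nat) : n%:R \in S.
  by elim: n => // n IHn; rewrite -addn1 natrD -[1%:R]opprK SB // SN.
case: k => n; first exact: Sn.
by rewrite NegzE rmorphN SN // Sn.
Qed.

Lemma exists_Fp_embedding (F : fieldType) p :
  p \in [pchar F] -> exists phi : {rmorphism 'F_p -> F}, True.
Proof.
move=> charFp.
pose phi : {rmorphism 'F_p -> pPrimeCharType charFp} :=
  GRing.in_alg (pPrimeCharType charFp).
by exists (phi : {rmorphism 'F_p -> F}).
Qed.

Lemma prime_field_Fp p (F : fieldType) (phi : {rmorphism 'F_p -> F}) x :
  prime_field (phi x).
Proof.
by rewrite -[x]natr_Zp rmorph_nat; apply: (@prime_field_int F (x : nat)).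
Qed.

Section RatEmbedding.

Variable F : fieldType.
Hypothesis charF : [pchar F] =i pred0.

(** The characteristic is an argument so that the morphism instances below can be attached to this
    map for any field of characteristic 0. *)
Definition char0_ratr of [pchar F] =i pred0 : rat -> F := @ratr F.
Local Notation toF := (char0_ratr charF).

Lemma pchar0_intr_eq0 (k : int) : (k%:~R == 0 :> F) = (k == 0).
Proof.
have /pcharf0P charF0 := charF.
by case: k => n; [apply: charF0 | rewrite NegzE rmorphN !oppr_eq0;
  apply: charF0].
Qed.

Lemma char0_ratrE (n d : int) :
  d != 0 -> toF (n%:~R / d%:~R) = n%:~R / d%:~R.
Proof.
move=> d0; set x := _ / _; rewrite /char0_ratr /ratr.
apply/eqP; rewrite eqr_div ?pchar0_intr_eq0 ?denq_neq0 // -!intrM; apply/eqP.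
congr _%:~R; apply: (@intr_inj rat); rewrite !intrM.
have dQ : d%:~R != 0 :> rat by rewrite intr_eq0.
have dQ' : (denq x)%:~R != 0 :> rat by rewrite intr_eq0 denq_neq0.
by apply/eqP; rewrite -eqr_div // divq_num_den.
Qed.

Lemma char0_ratr_zmod : zmod_morphism toF.
Proof.
move=> x y; rewrite -(divq_num_den x) -(divq_num_den y).
have nz z : (denq z)%:~R != 0 :> rat by rewrite intr_eq0 denq_neq0.
have nzF z : (denq z)%:~R != 0 :> F by rewrite pchar0_intr_eq0 denq_neq0.
rewrite -mulNr addf_div // -rmorphN /= -!intrM -intrD !char0_ratrE ?mulf_neq0
  ?denq_neq0 //.
by rewrite -mulNr addf_div // intrD !intrM rmorphN.
Qed.

Lemma char0_ratr_monoid : monoid_morphism toF.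
Proof.
split=> [|x y]; first by have := @char0_ratrE 1 1 isT; rewrite !rmorph1 !divr1.
rewrite -(divq_num_den x) -(divq_num_den y) mulf_div -!intrM.
by rewrite !char0_ratrE ?mulf_neq0 ?denq_neq0 // mulf_div -!intrM.
Qed.

HB.instance Definition _ :=
  GRing.isZmodMorphism.Build rat F toF char0_ratr_zmod.
HB.instance Definition _ :=
  GRing.isMonoidMorphism.Build rat F toF char0_ratr_monoid.

Lemma prime_field_ratr (x : rat) : prime_field (toF x).
Proof.
by rewrite -(divq_num_den x) char0_ratrE ?denq_neq0 //; apply: prime_field_div;
  apply: prime_field_int.
Qed.

End RatEmbedding.

(** * A criterion for the algebraic part to be algebraically closed *)

Lemma irreducible_factor (F : fieldType) (p : {poly F}) :
  (1 < size p)%N -> exists q, irreducible_poly q /\ q %| p.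
Proof.
move: {2}(size p) (leqnn (size p)) => n; elim: n p => [|n IHn] p pn p1.
  by rewrite leqn0 in pn; rewrite (eqP pn) in p1.
have p0 : p != 0 by rewrite -size_poly_gt0 (ltn_trans _ p1).
case: (classic (irreducible_poly p)) => [irrp|redp]; first by exists p.
have [q [q1 qp Nqp]] : exists q : {poly F},
    [/\ size q != 1%N, q %| p & ~ q %= p].
  apply: NNPP => H; apply: redp; split=> // q q1 qp.
  by apply: contraT => /negP ?; case: H; exists q.
have q0 : q != 0 by apply: contraTneq qp => ->; rewrite dvd0p.
have q_gt1 : (1 < size q)%N.
  by move: q1 q0; rewrite -size_poly_eq0; case: (size q) => [|[]].
have [|//|r [irrr rq]] := IHn q; last by exists r; split=> //;
  apply: dvdp_trans rq qp.
rewrite -ltnS; apply: leq_trans pn; rewrite ltn_neqAle dvdp_leq // andbT.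
by rewrite dvdp_size_eqp //; apply/negP.
Qed.

Lemma exists_root_extension (F : fieldType) (p : {poly F}) : (1 < size p)%N ->
  exists (L : fieldType) (iota : {rmorphism F -> L}) (z : L),
    root (map_poly iota p) z.
Proof.
move=> /irreducible_factor[q [/irredp_FAdjoin[L _ [z qz _]] qp]].
exists L, (in_alg L), z.
by apply: root_dvdp qz; rewrite dvdp_map.
Qed.

Lemma algebraic_part_algebraic (F0 F : fieldType) (phi : {rmorphism F0 -> F})
    (x : F) :
  algebraic_part F x -> algebraicOver phi x.
Proof.
move=> [p [p0 pP px]]; apply/integral_algebraic/(integral_root p0 px).
apply/integral_poly => i.
by have [r ->] := prime_field_fmorph phi (pP i); apply: integral_id.
Qed.

(** A zero, in an extension of F, of a polynomial over the algebraic part is algebraic over F0 by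
    transitivity; the second hypothesis puts it in F. *)
Lemma algebraic_part_closed (F0 F : fieldType) (phi : {rmorphism F0 -> F}) :
  (forall r, prime_field (phi r)) ->
  (forall (L : fieldType) (iota : {rmorphism F -> L}) (z : L),
     algebraicOver (iota \o phi) z -> exists x, z = iota x) ->
  algebraically_closed_subfield (algebraic_part F).
Proof.
move=> phiP descend p p1 pA.
have [L [iota [z pz]]] := exists_root_extension p1.
have p0 : p != 0 by rewrite -size_poly_gt0 (ltn_trans _ p1).
have algz : algebraicOver (iota \o phi) z.
  apply/integral_algebraic/(integral_root _ pz); first by rewrite map_poly_eq0.
  apply/integral_poly => i; rewrite coef_map.
  by apply/integral_rmorph/integral_algebraic/algebraic_part_algebraic.
have [x zE] := descend L iota z algz.
have [q q0 qz] := algz; exists x; last by rewrite -(fmorph_root iota) -zE.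
exists (map_poly phi q); rewrite map_poly_eq0 q0; split=> // [i|].
  by rewrite coef_map; apply: phiP.
by rewrite -(fmorph_root iota) -zE -map_poly_comp.
Qed.

(** * Characteristic p: roots of unity *)

Lemma unity_root_of_finite_powers (R : idomainType) (x : R) (s : seq R) :
  x != 0 -> (forall i, x ^+ i \in s) -> exists2 m, (0 < m)%N & x ^+ m = 1.
Proof.
move=> x0 xs; pose t := [seq x ^+ i | i <- iota 0 (size s).+1].
have : ~~ uniq t.
  have ts : {subset t <= s} by move=> _ /mapP[i _ ->].
  by apply/negP => /uniq_leq_size/(_ ts); rewrite size_map size_iota ltnn.
move=> /(uniqPn 0)[i [j []]]; rewrite size_map size_iota => ij jn.
rewrite !(nth_map 0) ?size_iota // ?(ltn_trans ij) // !nth_iota ?(ltn_trans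
  ij) //.
rewrite !add0n => E; exists (j - i)%N; first by rewrite subn_gt0.
by apply: (mulfI (expf_neq0 i x0)); rewrite -exprD subnKC ?(ltnW ij) // mulr1.
Qed.

(** Frobenius is injective, so factors p of the exponent can be removed. *)
Lemma unity_root_pchar_neq0 (R : fieldType) p (x : R) m :
  p \in [pchar R] -> (0 < m)%N -> x ^+ m = 1 ->
  exists m', [/\ (0 < m')%N, m'%:R != 0 :> R & x ^+ m' = 1].
Proof.
move=> charRp; elim/ltn_ind: m => m IHm m0 xm.
have [m00|?] := eqVneq (m%:R : R) 0; last by exists m.
move: m00 => /eqP; rewrite -(dvdn_pcharf charRp) => /dvdnP[k kE].
have k0 : (0 < k)%N by move: m0; rewrite kE; case: k {kE}.
apply: (IHm k) => //.
  by rewrite kE -{1}[k]muln1 ltn_pmul2l // prime_gt1 ?(pcharf_prime charRp).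
apply: (fmorph_inj (pFrobenius_aut charRp)).
by rewrite rmorph1 /= pFrobenius_autE -exprM -kE.
Qed.

(** Reduced modulo q, all powers of z are values at z of the finitely many polynomials over the
    prime field of degree below that of q. *)
Lemma algebraicOver_Fp_unity_root p (L : fieldType)
    (phi : {rmorphism 'F_p -> L}) z :
  p \in [pchar L] -> algebraicOver phi z -> z != 0 ->
  exists m, [/\ (0 < m)%N, m%:R != 0 :> L & z ^+ m = 1].
Proof.
move=> charLp [q q0 qz] z0; pose d := (size q).-1.
pose s := [seq (map_poly phi (rVpoly u)).[z] | u : 'rV['F_p]_d].
have [|m m0 zm] := @unity_root_of_finite_powers _ z s z0; last first.
  exact: unity_root_pchar_neq0 charLp m0 zm.
move=> i; apply/imageP; exists (poly_rV ('X^i %% q)) => //.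
rewrite poly_rV_K; last by rewrite -ltnS /d prednK ?size_poly_gt0 // ltn_modp.
have /(congr1 (fun r => (map_poly phi r).[z])) := divp_eq 'X^i q.
by rewrite map_polyXn hornerXn => ->;
  rewrite rmorphD rmorphM /= hornerD hornerM (rootP qz) mulr0 add0r.
Qed.

(** The assumption to be refuted. Coefficients are integers so that the polynomial can later be
    written as a parameter-free term; the condition on the leading coefficient preserves the degree
    over F. *)
Definition all_int_polys_have_roots (F : fieldType) := forall g : {poly int},
  (1 < size g)%N -> (lead_coef g)%:~R != 0 :> F ->
  separable_poly (map_poly intr g : {poly F}) ->
  exists x : F, root (map_poly intr g) x.

Lemma primitive_root_exists (F : fieldType) m : all_int_polys_have_roots F ->
  (0 < m)%N -> m%:R != 0 :> F -> exists x : F, m.-primitive_root x.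
Proof.
move=> rootsF m0 mF.
have prodE d : (0 < d)%N ->
    \prod_(e <- divisors d) map_poly intr 'Phi_e = 'X^d - 1 :> {poly F}.
  move=> d0; rewrite -rmorph_prod prod_Cyclotomic // rmorphB rmorph1 /=.
  by rewrite map_polyXn.
have sepm := separable_Xn_sub_1 mF.
have splitE : 'X^m - 1 = map_poly intr 'Phi_m *
     \prod_(e <- divisors m | e != m) map_poly intr 'Phi_e :> {poly F}.
  by rewrite -prodE // (big_rem m) ?divisors_id //= rem_filter ?divisors_uniq
    // big_filter.
have [|||x rx] := rootsF 'Phi_m.
- by rewrite size_Cyclotomic ltnS totient_gt0.
- by rewrite (monicP (Cyclotomic_monic m)) rmorph1 oner_eq0.
- by apply: dvdp_separable sepm; rewrite splitE dvdp_mulr.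
have xm1 : x ^+ m = 1.
  apply/eqP; rewrite -subr_eq0; have := rootP rx => rx0.
  by have := congr1 (fun p => p.[x]) splitE;
    rewrite hornerM rx0 mul0r !hornerE => ->.
(* If the order d of x were not m, x would also be a zero of some other cyclotomic factor of X^m -
   1, against separability. *)
exists x; have [d prd dm] := prim_order_exists m0 xm1.
have [-> //|dNm] := eqVneq m d.
have d0 : (0 < d)%N by apply: prim_order_gt0 prd.
have : root ('X^d - 1) x by rewrite rootE !hornerE (prim_expr_order prd) subrr.
rewrite -prodE // => rootd.
have [e ed re] : exists2 e, e \in divisors d & root (intpoly F 'Phi_e) x.
  elim: (divisors d) rootd => [|e s IHs];
    first by rewrite big_nil rootC oner_eq0.
  rewrite big_cons rootM => /orP[re|/IHs[e' e's re']]; first by exists e;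
    rewrite ?mem_head.
  by exists e' => //; rewrite inE e's orbT.
have em : (e %| m)%N by apply: dvdn_trans dm; rewrite dvdn_divisors.
have eNm : e != m.
  apply: contraNneq dNm => em'; rewrite eqn_dvd dm andbT -em' dvdn_divisors //.
have := sepm; rewrite splitE =>
  /separable_coprime/(_ (dvdpp _))/coprimep_root/(_ rx).
rewrite horner_prod => /negP[]; rewrite prodf_seq_eq0; apply/hasP; exists e.
  by rewrite -dvdn_divisors.
by rewrite eNm.
Qed.

(** Nonzero elements algebraic over the prime field are roots of unity of order invertible in F, and
    F contains a primitive root of each such order. *)
Lemma all_int_polys_pchar (F : fieldType) p :
  all_int_polys_have_roots F -> p \in [pchar F] ->
  algebraically_closed_subfield (algebraic_part F).
Proof.
move=> rootsF charFp; have [phi _] := exists_Fp_embedding charFp.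
apply: (algebraic_part_closed (phi := phi)) => [r|L iota z algz].
  exact: prime_field_Fp.
have [->|z0] := eqVneq z 0; first by exists 0; rewrite rmorph0.
have charLp : p \in [pchar L] by rewrite (fmorph_pchar iota).
have [m [m0 mL zm]] := algebraicOver_Fp_unity_root charLp algz z0.
have mF : m%:R != 0 :> F by rewrite -(fmorph_eq0 iota) rmorph_nat.
have [x prx] := primitive_root_exists rootsF m0 mF.
have prLx : m.-primitive_root (iota x) by rewrite fmorph_primitive_root.
have [i ->] := prim_rootP prLx zm.
by exists (x ^+ i); rewrite rmorphXn.
Qed.

(** * Characteristic 0: primitive elements *)

Local Notation pQtoC := (map_poly (ratr : rat -> algC)).

Lemma separable_minCpoly g (q : {poly rat}) : minCpoly g = pQtoC q ->
  (forall r, root (pQtoC r) g = (q %| r)) -> separable_poly q.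
Proof.
move=> qE qP; have q1 : (1 < size q)%N.
  by have := size_minCpoly g; rewrite qE size_map_poly.
have q0 : q != 0 by rewrite -size_poly_gt0 (ltn_trans _ q1).
have q'0 : q^`() != 0.
  apply/eqP => /polyP/(_ (size q).-2)/eqP.
  rewrite coef_deriv coef0 prednK -?subn1 ?subn_gt0 // subn1.
  by rewrite -lead_coefE mulrn_eq0 lead_coef_eq0 (negPf q0) -subn1 subn_eq0
    leqNgt q1.
rewrite unlock /coprimep; have /Pdiv.Field.dvdpP[u uE] := dvdp_gcdl q q^`().
have : root (pQtoC q) g by rewrite qP dvdpp.
(* g is a zero of u or of the gcd. By minimality q divides that factor: the first forces a constant
   gcd, the second contradicts the degree of q'. *)
rewrite {1}uE rmorphM rootM !qP =>
  /orP[qu|/dvdp_trans/(_ (dvdp_gcdr _ _))/(dvdp_leq q'0)].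
  have u0 : u != 0 by apply: contraNneq q0 => u0; rewrite uE u0 mul0r.
  have d0 : gcdp q q^`() != 0 by rewrite gcdp_eq0 negb_and q0.
  have := dvdp_leq u0 qu;
    rewrite {1}uE size_mul // -subn1 leq_subLR addnC leq_add2r.
  by rewrite eqn_leq size_poly_gt0 d0 andbT.
by rewrite leqNgt lt_size_deriv.
Qed.

Lemma all_int_polys_pchar0 (F : fieldType) :
  all_int_polys_have_roots F -> [pchar F] =i pred0 ->
  algebraically_closed_subfield (algebraic_part F).
Proof.
move=> rootsF charF; pose phi : {rmorphism rat -> F} := char0_ratr charF.
apply: (algebraic_part_closed (phi := phi)) => [r|L iota z [q q0 qz]].
  exact: prime_field_ratr.
have [rs rsE] := closed_field_poly_normal (pQtoC q).
have [g _ [ps psE]] := algC_PET rs.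
have [m [mE monm mP]] := minCpolyP g.
(* Inside the algebraic numbers, g generates a field containing all zeros of q. Its minimal
   polynomial m, scaled to integer coefficients, has a zero x in F, which will play the part of
   g. *)
have [x mx] : exists x, root (map_poly phi m) x.
  have [mZ [a a0 maE]] := rat_poly_scale m.
  have mF : map_poly intr mZ = a%:~R *: map_poly phi m.
    rewrite maE map_polyZ /= scalerA fmorphV rmorph_int mulfV ?pchar0_intr_eq0
      // scale1r.
    by rewrite -map_poly_comp; apply: eq_map_poly => k; rewrite /= rmorph_int.
  have [|||x] := rootsF mZ.
  - by have := size_minCpoly g;
      rewrite mE size_map_poly maE size_scale ?invr_eq0 ?intr_eq0 //
      size_rat_int_poly.
  - rewrite pchar0_intr_eq0 // lead_coef_eq0.
    by apply: contraTneq monm => mZ0;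
      rewrite maE mZ0 rmorph0 scaler0 monicE lead_coef0.
  - rewrite mF (@eqp_separable _ _ (map_poly phi m)) ?separable_map.
      exact: separable_minCpoly mE mP.
    by rewrite eqp_scale // pchar0_intr_eq0.
  by rewrite mF rootZ ?pchar0_intr_eq0 //; exists x.
(* W(X,Y) expresses that q splits with zeros p(X), p in [ps]. It vanishes at X = g, so m divides its
   coefficients and it vanishes at X = x too. *)
pose W : {poly {poly rat}} :=
  (lead_coef q)%:P *: \prod_(p <- ps) ('X - p%:P) - q^:P.
have mapW (K : fieldType) (eta : {rmorphism rat -> K}) y :
    map_poly (horner_eval y \o map_poly eta) W =
    eta (lead_coef q) *: \prod_(p <- ps) ('X - (map_poly eta p).[y]%:P) -
      map_poly eta q.
  pose ev : {rmorphism {poly rat} -> K} := horner_eval y \o map_poly eta.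
  rewrite -[_ \o _]/(ev : _ -> _).
  have evC k : ev k%:P = eta k by rewrite /ev /= map_polyC /= /horner_eval
    hornerC.
  rewrite rmorphB /= map_polyZ evC rmorph_prod -map_poly_comp /=.
  rewrite (eq_map_poly evC); congr (_ *: _ - _).
  by apply: eq_bigr => p _; rewrite rmorphB /= map_polyX map_polyC.
have WC : map_poly (horner_eval g \o pQtoC) W = 0.
  rewrite mapW rsE psE big_map lead_coef_map; apply/eqP; rewrite subr_eq0.
  done.
have WF : map_poly (horner_eval x \o map_poly phi) W = 0.
  apply/polyP => i; rewrite coef_map coef0 /= /horner_eval.
  have : root (pQtoC W`_i) g.
    by have /polyP/(_ i) := WC;
      rewrite coef_map coef0 /= /horner_eval => /rootP.
  by rewrite mP => mW; apply/rootP/(root_dvdp _ mx); rewrite dvdp_map.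
have qE : map_poly phi q =
    phi (lead_coef q) *: \prod_(p <- ps) ('X - (map_poly phi p).[x]%:P).
  by apply/esym/eqP; rewrite -subr_eq0 -mapW WF.
move: qz; rewrite map_poly_comp qE map_polyZ rootZ; last first.
  by rewrite /= !fmorph_eq0 lead_coef_eq0.
rewrite rmorph_prod /= => zr.
have : z \in [seq iota (map_poly phi p).[x] | p <- ps].
  rewrite -root_prod_XsubC big_map; move: zr; congr root; apply: eq_bigr => p _.
  by rewrite rmorphB /= map_polyX map_polyC.
by case/mapP => p _ ->; exists (map_poly phi p).[x].
Qed.

Lemma exists_int_poly_without_root (F : fieldType) :
  ~ algebraically_closed_subfield (algebraic_part F) ->
  exists g : {poly int}, [/\ (1 < size g)%N, (lead_coef g)%:~R != 0 :> F,
    separable_poly (map_poly intr g : {poly F}) &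
    forall x : F, ~~ root (map_poly intr g) x].
Proof.
move=> NcF; apply: NNPP => Ng; apply: NcF.
have rootsF : all_int_polys_have_roots F.
  move=> g g1 lg sg; apply: NNPP => Nr; apply: Ng; exists g; split=> // x.
  by apply/negP => rx; apply: Nr; exists x.
case: (classic (exists p, p \in [pchar F])) => [[p charFp]|Nchar].
  exact: all_int_polys_pchar charFp.
apply: all_int_polys_pchar0 => // p; apply/negP => charFp.
by apply: Nchar; exists p.
Qed.

(** * Definability of the valuation ring *)

Section ValuationRing.

Variables (K : fieldType) (O : valuationRing K).
Local Notation F := (residue_field O).

Lemma residue_surj (x : F) : exists a : valring O, residue a = x.
Proof.
exists (repr (x : {ideal_quot (@maxideal K O : idealr (valring O))})).
exact: reprK.
Qed.

Lemma residue_unit (a : valring O) : residue a != 0 ->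
  val a != 0 /\
  exists b : valring O, val b = (val a)^-1 /\ residue b = (residue a)^-1.
Proof.
move=> ra; have ma : a \notin maxideal (O := O) by rewrite -residue_eq0.
have a0 : val a != 0 by move: ma; rewrite negb_or => /andP[].
split=> //; exists (ValRing (valring_unitP ma)); split=> //.
apply: (mulfI ra); rewrite mulfV // -rmorphM -(rmorph1 (@residue K O)).
by congr residue; apply: val_inj; rewrite rmorphM rmorph1 /= mulfV.
Qed.

Lemma notin_valring_inv (x : K) : x \notin O ->
  x != 0 /\ exists b : valring O, val b = x^-1 /\ residue b = 0.
Proof.
move=> xO; have x0 : x != 0 by apply: contraNneq xO => ->; rewrite rpred0.
split=> //; have Ox : x^-1 \in O by have := @valuation_ring_total K O x;
  rewrite (negPf xO).
exists (ValRing Ox); split=> //; apply/eqP; rewrite residue_eq0.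
by apply/orP; right; rewrite /= invrK.
Qed.

Lemma val_intpoly (f : {poly int}) (a : valring O) :
  val (intpoly (valring O) f).[a] = (intpoly K f).[val a].
Proof.
rewrite -horner_map -map_poly_comp; congr _.[_].
by apply: eq_map_poly => k; rewrite -[LHS]/(val (k%:~R : valring O)) rmorph_int.
Qed.

Lemma residue_intpoly (f : {poly int}) (a : valring O) :
  residue (intpoly (valring O) f).[a] = (intpoly F f).[residue a].
Proof.
rewrite -horner_map -map_poly_comp; congr _.[_].
by apply: eq_map_poly => k; rewrite /= rmorph_int.
Qed.

Section IntegralPolynomial.

Variable f : {poly int}.
Hypotheses (f_gt1 : (1 < size f)%N) (lead_f : (lead_coef f)%:~R != 0 :> F).

Lemma intpoly_notin (x : K) : x \notin O ->
  exists b : valring O,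
    [/\ (intpoly K f).[x] != 0, val b = (intpoly K f).[x]^-1 & residue b = 0].
Proof.
move=> /notin_valring_inv[x0 [y [yE ry]]].
(* This is f(x) / x^(deg f), written in y = 1/x. Only the leading coefficient survives in its
   residue, so it is a unit. *)
pose r := \sum_(i < size f) (f`_i)%:~R * y ^+ ((size f).-1 - i).
have rr : residue r = (lead_coef f)%:~R.
  rewrite rmorph_sum /= lead_coefE; case: (size f) f_gt1 => //= n n1.
  rewrite big_ord_recr /= subnn mulr1 rmorph_int big1 ?add0r // => i _.
  by rewrite rmorphM rmorphXn /= ry expr0n subn_eq0 leqNgt ltn_ord mulr0.
have fxE : (intpoly K f).[x] = x ^+ (size f).-1 * val r.
  rewrite (@horner_coef_wide _ (size f)) ?size_poly // rmorph_sum mulr_sumr.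
  apply: eq_bigr => i _;
    rewrite coef_map_id0 // rmorphM rmorphXn rmorph_int /= yE.
  rewrite mulrCA exprVn -expfB_cond ?(negPf x0) ?add0n ?leq_subr //.
  by rewrite subKn // -ltnS prednK // (leq_trans _ (ltn_ord i)).
have [r0 [b [bE _]]] : val r != 0 /\ exists b : valring O,
    val b = (val r)^-1 /\ residue b = (residue r)^-1.
  by apply: residue_unit; rewrite rr.
exists (y ^+ (size f).-1 * b); split.
- by rewrite fxE mulf_neq0 ?expf_neq0.
- by rewrite rmorphM rmorphXn /= yE bE fxE invfM exprVn.
rewrite rmorphM rmorphXn /= ry expr0n; case: (size f) f_gt1 => [|[|n]] //= _.
by rewrite mul0r.
Qed.

Hypothesis no_root : forall x : F, ~~ root (intpoly F f) x.

Lemma intpoly_inv_valring (x : K) :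
  (intpoly K f).[x] != 0 /\ (intpoly K f).[x]^-1 \in O.
Proof.
have [Ox|/intpoly_notin[b [fx0 <- _]]] := boolP (x \in O); last first.
  by split=> //; apply: valP.
pose a := ValRing Ox; have : residue (intpoly (valring O) f).[a] != 0.
  by rewrite residue_intpoly; apply: no_root.
move=> /residue_unit; rewrite val_intpoly /= => -[fx0 [b [<- _]]].
by split=> //; apply: valP.
Qed.

End IntegralPolynomial.

Hypothesis henselianO : henselian O.

Lemma henselian_solve (f : {poly int}) (a : F) (u : valring O) :
  (intpoly F f)^`().[a] != 0 -> residue u = (intpoly F f).[a] ->
  exists z : K, (intpoly K f).[z] = val u.
Proof.
move=> f'a uE; pose g := intpoly (valring O) f - u%:P.
have gE : map_poly (@residue K O) g = intpoly F f - (residue u)%:P.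
  rewrite rmorphB /= map_polyC -map_poly_comp; congr (_ - _).
  by apply: eq_map_poly => k; rewrite /= rmorph_int.
have [|| z gz _] := henselianO (f := g) (alpha := a).
- by rewrite gE rootE !hornerE uE subrr.
- by rewrite gE derivB derivC subr0.
exists (val z); rewrite -val_intpoly; congr val.
by apply/eqP; rewrite -subr_eq0; move: gz; rewrite rootE !hornerE.
Qed.

(** With w a lift of a, e + 1/f(w) is a unit with residue 1/f(a). Hensel's lemma at the same simple
    point a then solves 1/f(z) = e + 1/f(w). *)
Lemma maxideal_difference (f : {poly int}) (a : F) (e : valring O) :
  (intpoly F f)^`().[a] != 0 -> ~~ root (intpoly F f) a -> residue e = 0 ->
  exists z w : K, val e = (intpoly K f).[z]^-1 - (intpoly K f).[w]^-1.
Proof.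
move=> f'a fa re; have [w rw] := residue_surj a.
have : residue (intpoly (valring O) f).[w] != 0 by rewrite residue_intpoly rw.
move=> /residue_unit; rewrite val_intpoly => -[fw0 [b [bE rb]]].
have reb : residue (e + b) = (intpoly F f).[a]^-1.
  by rewrite rmorphD /= re add0r rb residue_intpoly rw.
have : residue (e + b) != 0 by rewrite reb invr_eq0.
move=> /residue_unit[eb0 [u [uE ru]]].
have [|z fz] := henselian_solve (u := u) f'a; first by rewrite ru reb invrK.
by exists z, (val w); rewrite fz uE invrK -bE rmorphD /= addrK.
Qed.

End ValuationRing.

(** * Integer polynomials as ring terms *)

Section Terms.

Variable R : unitRingType.

(** The language has no numerals beyond 0 and 1, so integers are spelled out as sums of ones. *)
Definition nat_term (n : nat) : GRing.term R :=
  iter n (GRing.Add (GRing.NatConst R 1)) (GRing.NatConst R 0).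

Definition int_term (k : int) : GRing.term R :=
  match k with
  | Posz n => nat_term n
  | Negz n => GRing.Opp (nat_term n.+1)
  end.

Definition poly_term (f : {poly int}) (t : GRing.term R) : GRing.term R :=
  foldr (fun c u => GRing.Add (GRing.Mul u t) (int_term c)) 
    (GRing.NatConst R 0) f.

Lemma ring_nat_term vs n : ring_term vs (nat_term n).
Proof. by elim: n. Qed.

Lemma ring_poly_term vs f t : ring_term vs t -> ring_term vs (poly_term f t).
Proof.
move=> vst; rewrite /poly_term; elim: (f : seq int) => //= c s ->.
by rewrite vst; case: c => n /=; rewrite ring_nat_term.
Qed.

Lemma eval_nat_term e n : GRing.eval e (nat_term n) = n%:R.
Proof.
elim: n => [//|n IHn].
by rewrite -[LHS]/(1%:R + GRing.eval e (nat_term n)) IHn -natrD.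
Qed.

Lemma eval_int_term e k : GRing.eval e (int_term k) = k%:~R.
Proof.
case: k => n; first exact: eval_nat_term.
by rewrite -[LHS]/(- GRing.eval e (nat_term n.+1)) eval_nat_term NegzE rmorphN.
Qed.

Lemma eval_poly_term e f t :
  GRing.eval e (poly_term f t) = (intpoly R f).[GRing.eval e t].
Proof.
rewrite map_polyE horner_Poly /poly_term; elim: (f : seq int) => //= c s ->.
by rewrite eval_int_term.
Qed.

End Terms.

(** * The defining formulas *)

Lemma finite_field_exponent (F : fieldType) : finite_field F ->
  exists2 n, (1 < n)%N & forall x : F, x ^+ n = x.
Proof.
move=> [s sP].
suff [m m0 mP] : exists2 m, (0 < m)%N & forall x, x \in s ->
    x != 0 -> x ^+ m = 1.
  exists m.+1 => // x; have [->|x0] := eqVneq x 0; first by rewrite expr0n.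
  by rewrite exprS mP ?mulr1.
(* Only the list of elements treated so far shrinks; the full enumeration s stays for the pigeonhole
   argument. Exponents are multiplied. *)
elim: {1}s => [|y t [m m0 mP]]; first by exists 1%N.
have [y0|y0] := eqVneq y 0.
  exists m => // x; rewrite inE => /orP[/eqP->|/mP //]; by rewrite y0 eqxx.
have [k k0 yk] := @unity_root_of_finite_powers _ y s y0 (fun i => sP _).
exists (k * m)%N => [|x]; first by rewrite muln_gt0 k0.
rewrite inE => /orP[/eqP-> _|xt x0]; first by rewrite exprM yk expr1n.
by rewrite mulnC exprM mP ?expr1n.
Qed.

Lemma exists_nonroot (F : fieldType) (p : {poly F}) :
  ~ finite_field F -> p != 0 -> exists x, p.[x] != 0.
Proof.
move=> infF p0; apply: NNPP => Np.
have rootp x : root p x by apply: contraT => Nr; case: Np; exists x.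
have [s s_uniq] : exists2 s : seq F, uniq s & size s = size p.
  elim: (size p) => [|n [s us sn]]; first by exists [::].
  have [x xs] : exists x, x \notin s.
    by apply: NNPP => Nx; apply: infF; exists s => x; apply: contraT => xs;
      case: Nx; exists x.
  by exists (x :: s) => /=; rewrite ?xs ?sn.
have := @max_poly_roots _ p s p0; rewrite -[all _ _]/(all (root p) s).
by rewrite (introT allP) // => /(_ isT s_uniq) => + E; rewrite E ltnn.
Qed.

Lemma definition_finite_residue_field (K : fieldType) (O : valuationRing K) :
  henselian O -> finite_field (residue_field O) ->
  exists phi : GRing.formula K, existential_definition O phi.
Proof.
move=> hensO /finite_field_exponent[n n1 nP].
pose f : {poly int} := 'X^n - 'X + 1.
have fE (R : nzRingType) : intpoly R f = 'X^n - 'X + 1.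
  by rewrite rmorphD rmorphB rmorph1 /= map_polyXn map_polyX.
have fF (x : residue_field O) : (intpoly (residue_field O) f).[x] = 1.
  by rewrite fE !hornerE nP subrr add0r.
have size_f : size f = n.+1.
  rewrite /f -addrA [- 'X + 1]addrC -opprB -polyC1 size_polyDl size_polyXn //.
  by rewrite size_polyN size_XsubC ltnS.
have lead_f : lead_coef f = 1.
  rewrite lead_coefE size_f /= /f !coefE eqxx.
  by case: n n1 {nP f fE fF size_f} => [|[|n]].
have noroot x : ~~ root (intpoly (residue_field O) f) x.
  by rewrite rootE fF oner_eq0.
have f1 : (1 < size f)%N by rewrite size_f ltnS ltnW.
have lf : (lead_coef f)%:~R != 0 :> residue_field O by rewrite lead_f oner_eq0.
exists (GRing.Exists 1 (GRing.Equal
  (GRing.Mul (poly_term f (GRing.Var K 0)) (poly_term f (GRing.Var K 1)))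
  (GRing.NatConst K 1))).
split=> [|x]; first by rewrite /= !ring_poly_term.
rewrite /= ; split=> [[y]|Ox].
  rewrite !eval_poly_term /= => fxy.
  apply: contraT => /(intpoly_notin f1 lf)[b [fx0 bE rb]].
  have [fy0 Ofy] := intpoly_inv_valring f1 lf noroot y.
  have fyE : (intpoly K f).[y]^-1 = (intpoly K f).[x].
    by apply: (mulIf fy0); rewrite mulVf.
  (* If x were outside O, 1 would be the product of 1/f(x) in m and 1/f(y) in O. *)
  have /eqP := oner_neq0 (residue_field O); case;
    rewrite -(rmorph1 (@residue K O)).
  have -> : 1 = b * ValRing Ofy :> valring O.
    by apply: val_inj; rewrite rmorphM rmorph1 /= bE fyE mulVf.
  by rewrite rmorphM /= rb mul0r.
pose a := ValRing Ox.
have /residue_unit[fx0 [b [bE rb]]] : residue (intpoly (valring O) f).[a] != 0.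
  by rewrite residue_intpoly fF oner_eq0.
(* Hensel's lemma applies at 0: f'(0) = -1 since n > 1, and 1/f(x) has residue 1 = f(0). *)
have [||y fy] := henselian_solve hensO (f := f) (a := 0) (u := b).
- rewrite fE !derivE !hornerE hornerMn hornerXn expr0n -subn1 subn_eq0 leqNgt
    n1.
  by rewrite mul0rn sub0r oppr_eq0 oner_eq0.
- by rewrite rb residue_intpoly !fF invr1.
exists y; rewrite !eval_poly_term /= fy bE -[x]/(val a) -val_intpoly.
by rewrite mulfV.
Qed.

(** Ring formulas exclude inverses, so the equations are stated with denominators cleared; the
    denominators will be values of f, which never vanish. *)
Lemma eq_subV (K : fieldType) (x c d : K) : c != 0 -> d != 0 ->
  x * (c * d) + c = d <-> x = c^-1 - d^-1.
Proof.
move=> c0 d0; have cd0 : c * d != 0 by rewrite mulf_neq0.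
have -> : c^-1 - d^-1 = (d - c) / (c * d).
  by rewrite mulrBl invfM mulrCA mulfV // mulr1 mulrA mulfV // mul1r.
split=> [E|->]; last by rewrite divfK // subrK.
by apply: (canRL (mulfK cd0)); rewrite -[X in X - c]E addrK.
Qed.

Lemma eq_addV_subV (K : fieldType) (x b c d : K) : b != 0 -> c != 0 -> d != 0 ->
  x * (b * (c * d)) + b * c = c * d + b * d <-> x = b^-1 + (c^-1 - d^-1).
Proof.
move=> b0 c0 d0; have -> : x = b^-1 + (c^-1 - d^-1) <-> x - b^-1 = c^-1 - d^-1.
  by split=> [->|<-]; rewrite addrC ?addKr // subrK.
rewrite -eq_subV //; have bV :
  (x - b^-1) * (c * d) * b = x * (b * (c * d)) - c * d.
  by rewrite mulrAC mulrBl mulVf // mulrBl mul1r -mulrA.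
split=> E.
  apply: (mulfI b0); rewrite mulrDr mulrC bV.
  by rewrite addrAC E addrC addKr.
have -> : b * d = x * (b * (c * d)) - c * d + b * c.
  by rewrite -bV -{1}E mulrDr; congr (_ + _); rewrite mulrC.
by rewrite addrA [c * d + _]addrC subrK.
Qed.

Lemma definition_pac_residue_field (K : fieldType) (O : valuationRing K) :
  henselian O -> ~ finite_field (residue_field O) ->
  pseudo_algebraically_closed (residue_field O) ->
  ~ algebraically_closed_subfield (algebraic_part (residue_field O)) ->
  exists phi : GRing.formula K, existential_definition O phi.
Proof.
move=> hensO infF pacF /exists_int_poly_without_root[f [f1 lf sepf noroot]].
set F := residue_field O in infF pacF lf sepf noroot.
have size_fF : size (intpoly F f) = size f by rewrite size_map_poly_id0.
have [a f'a] : exists a, (intpoly F f)^`().[a] != 0.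
  apply: exists_nonroot infF _.
  by rewrite (separable_deriv_eq0 sepf (dvdpp _)) // size_fF.
have fK0 x := (intpoly_inv_valring f1 lf noroot x).1.
have OfK x := (intpoly_inv_valring f1 lf noroot x).2.
pose X i := GRing.Var K i; pose P i := poly_term f (X i).
pose difference :=
  (X 0%N * (P 3%N * P 4%N) + P 3%N == P 4%N)%T : GRing.formula K.
pose shifted :=
  (X 0%N * (P 1%N * P 2%N * (P 3%N * P 4%N)) + P 1%N * P 2%N * P 3%N ==
   P 3%N * P 4%N + P 1%N * P 2%N * P 4%N)%T : GRing.formula K.
exists (GRing.Exists 1 (GRing.Exists 2 (GRing.Exists 3 (GRing.Exists 4
  (GRing.Or difference shifted))))).
split=> [|x]; first by rewrite /= !ring_poly_term.
rewrite /difference /shifted /P /X /=; split.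
  move=> [y1 [y2 [z [w]]]]; rewrite !eval_poly_term /= eq_subV //.
  rewrite eq_addV_subV ?mulf_neq0 // invfM.
  by case=> ->; rewrite ?(rpredD, rpredN, rpredM).
move=> Ox; pose c := ValRing Ox.
have [rc|rc] := eqVneq (residue c) 0.
  have [z [w E]] := maxideal_difference hensO f'a (noroot a) rc.
  (* Both disjuncts share one quantifier prefix; [difference] does not mention the first two
     variables, so 0 is a dummy. *)
  exists 0, 0, z, w; left; rewrite !eval_poly_term /=.
  by apply/eq_subV.
(* The PAC property gives 1/(f(y1) f(y2)) equal to the residue of x. For lifts v1, v2 the
   corresponding element b of O differs from x by an element of m. *)
have [||y1 [y2 yE]] := pac_product_solution (f := intpoly F f)
  (c := (residue c)^-1) pacF _ sepf.
- by rewrite size_fF.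
- by rewrite invr_eq0.
have [[v1 rv1] [v2 rv2]] := (residue_surj y1, residue_surj y2).
pose Y := intpoly (valring O) f.
have rY : residue (Y.[v1] * Y.[v2]) = (residue c)^-1.
  by rewrite rmorphM /= !residue_intpoly rv1 rv2.
have /residue_unit[_ [b [bE rb]]] : residue (Y.[v1] * Y.[v2]) != 0.
  by rewrite rY invr_eq0.
have [|z [w E]] := maxideal_difference hensO f'a (noroot a) (e := c - b).
  by rewrite rmorphB /= rb rY invrK subrr.
exists (val v1), (val v2), z, w; right; rewrite !eval_poly_term /=.
apply/eq_addV_subV; rewrite ?mulf_neq0 //.
by rewrite -E -!val_intpoly -rmorphM -bE rmorphB addrC subrK.
Qed.

Theorem theorem1p1 (K : fieldType) (O : valuationRing K) :
  henselian O ->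
  finite_field (residue_field O) \/
    pseudo_algebraically_closed (residue_field O) ->
  ~ algebraically_closed_subfield (algebraic_part (residue_field O)) ->
  exists phi : GRing.formula K, existential_definition O phi.
Proof.
move=> hensO finF_or_pacF NcF.
(* The PAC argument is run over infinite F, where f' has a nonzero value. *)
have [finF|infF] := classic (finite_field (residue_field O)).
  exact: definition_finite_residue_field.
by case: finF_or_pacF => // pacF; apply: definition_pac_residue_field.
Qed.
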